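(* Let $f,g:K_1\to K_2$ be triangle-collapsing simplicial morphisms of ordered simplicial complexes. Identify $\mathrm{Cyl}(\sigma(K_1))$ with $\sigma(\overline{\mathrm{Cyl}(K_1)})$ via the natural isomorphism $\phi$ described in the context. 1. If $F:\overline{\mathrm{Cyl}(K_1)}\to K_2$ is a one-step $\mathcal S_{\mathbf{TcOSC}}$-homotopy from $f$ to $g$, then $\sigma(F)$ is a one-step $\mathcal S_{\mathbf{sSet}}$-homotopy from $\sigma(f)$ to $\sigma(g)$. 2. If $F:\mathrm{Cyl}(\sigma(K_1))\to\sigma(K_2)$ is a one-step $\mathcal S_{\mathbf{sSet}}$-homotopy from $\sigma(f)$ to $\sigma(g)$, then $\sigma^{-1}(F)$ (the unique morphism of $\mathbf{TcOSC}$ mapped by the full and faithful functor $\sigma$ to $F$) is a one-step $\mathcal S_{\mathbf{TcOSC}}$-homotopy from $f$ to $g$. In particular, the pull-back system along $\sigma$ is $\sigma^\ast\mathcal S_{\mathbf{sSet}}=\mathcal S_{\mathbf{TcOSC}}$.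
   Context: A path $v_0\dots v_k$ on a set $V$ is simplicial if all $v_i$ are distinct. An ordered simplicial complex on $V=V(K)$ is a set $K$ of simplicial paths on $V$ containing all singletons and closed under deleting any one vertex. A triangle-collapsing simplicial morphism $K_1\to K_2$ is a map $f:V(K_1)\to V(K_2)$ such that for each $p\in K_1$, $f(p)$ is non-simplicial or in $K_2$, and such that $v_0v_1v_2\in K_1$ with $f(v_0)=f(v_2)$ implies $f(v_0)=f(v_1)=f(v_2)$. $\mathbf{TcOSC}$ is the resulting category. For an ordered simplicial complex $K$, $\mathrm{Cyl}(K)$ is the set of paths on $V(K)\times\{0,1\}$ of the forms $(v_0,0)\dots(v_k,0)$, $(v_0,1)\dots(v_k,1)$, $(v_0,0)\dots(v_i,0)(v_i,1)\dots(v_k,1)$ ($0\le i\le k$) with $v_0\dots v_k\in K$; $\overline{\mathrm{Cyl}(K)}$ is the smallest ordered simplicial complex containing it. Write $\iota_j(v)=(v,j)$, $j=0,1$. A one-step $\mathcal S_{\mathbf{TcOSC}}$-homotopy from $f$ to $g$ (both $K_1\to K_2$) is a triangle-collapsing simplicial morphism $F:\overline{\mathrm{Cyl}(K_1)}\to K_2$ with $F\circ\iota_0=f$, $F\circ\iota_1=g$. The $n$-th ordinal $[n]$ is the ordered simplicial complex on $\{0,\dots,n\}$ of all strictly increasing sequences; the simplex category $\Delta$ is the full subcategory of $\mathbf{TcOSC}$ on the ordinals (morphisms are weakly increasing functions). $\mathbf{sSet}$ is the category of functors $\Delta^{op}\to\mathbf{Set}$. The functor $\sigma:\mathbf{TcOSC}\to\mathbf{sSet}$,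 $\sigma(K)([n])=\mathrm{Mor}_{\mathbf{TcOSC}}([n],K)$ (restricted Yoneda embedding), is full and faithful. For a simplicial set $S$, $\mathrm{Cyl}(S)=S\times\sigma([1])$ (product in $\mathbf{sSet}$), with $e_j:S\to\mathrm{Cyl}(S)$, $\tau\mapsto(\tau,c_j)$, where $c_j:[n]\to[1]$ is constant at $j$ ($j=0,1$). A one-step $\mathcal S_{\mathbf{sSet}}$-homotopy from $a$ to $b$ (simplicial maps $S_1\to S_2$) is a simplicial map $F:\mathrm{Cyl}(S_1)\to S_2$ with $F\circ e_0=a$, $F\circ e_1=b$. The two coordinate projections $\pi_K:\overline{\mathrm{Cyl}(K)}\to K$ and $\pi_{[1]}:\overline{\mathrm{Cyl}(K)}\to[1]$ are triangle-collapsing simplicial morphisms, and $\phi:\sigma(\overline{\mathrm{Cyl}(K)})\to\mathrm{Cyl}(\sigma(K))$, $p\mapsto(\pi_K\circ p,\pi_{[1]}\circ p)$, is an isomorphism natural in $K$. A system of one-step homotopies $\mathcal S$ for a category $\mathcal C$ is a choice of simple digraph (no self-loops) $\mathcal S(C_1,C_2)$ on the vertex set $\mathrm{Mor}_{\mathcal C}(C_1,C_2)$ for every pair of objects. The system $\mathcal S_{\mathbf{TcOSC}}$ for $\mathbf{TcOSC}$ has, for triangle-collapsing simplicial morphisms $f\ne g$ from $K_1$ to $K_2$, an edge $f\to g$ iff there exists a triangle-collapsing simplicial morphism $F:\overline{\mathrm{Cyl}(K_1)}\to K_2$ with $F\circ\iota_0=f$ and $F\circ\iota_1=g$ (a one-step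 $\mathcal S_{\mathbf{TcOSC}}$-homotopy from $f$ to $g$). The system $\mathcal S_{\mathbf{sSet}}$ for $\mathbf{sSet}$ has, for simplicial maps $a\ne b$ from $S_1$ to $S_2$, an edge $a\to b$ iff there exists a simplicial map $F:\mathrm{Cyl}(S_1)\to S_2$ with $F\circ e_0=a$ and $F\circ e_1=b$ (a one-step $\mathcal S_{\mathbf{sSet}}$-homotopy from $a$ to $b$). The pull-back of $\mathcal S$ along $\mu:\mathcal C\to\mathcal D$ is the system $\mu^\ast\mathcal S$ with, for $f\neq g$, $f\to g$ iff $\mu(f)=\mu(g)$ or $\mu(f)\to\mu(g)$ in $\mathcal S(\mu(C_1),\mu(C_2))$. *)

(* Defs.v *)
Set Warnings "-notation-overridden".
From mathcomp Require Import all_boot boolp.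
From Stdlib Require List.

Set Implicit Arguments.
Unset Strict Implicit.
Unset Printing Implicit Defensive.

Record category := Category {
  obj :> Type;
  hom : obj -> obj -> Type;
  idm : forall X, hom X X;
  ccomp : forall X Y Z, hom Y Z -> hom X Y -> hom X Z;
  comp_idl : forall X Y (f : hom X Y), ccomp (idm Y) f = f;
  comp_idr : forall X Y (f : hom X Y), ccomp f (idm X) = f;
  comp_assoc : forall X Y Z T (h : hom Z T) (g : hom Y Z) (f : hom X Y),
    ccomp h (ccomp g f) = ccomp (ccomp h g) f }.

Arguments hom C X Y : rename, clear implicits.
Arguments idm C X : rename, clear implicits.
Arguments ccomp {C X Y Z} : rename.

Declare Scope cat_scope.
Notation "g \oc f" := (ccomp g f) (at level 50, left associativity) : cat_scope.
Local Open Scope cat_scope.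

Record functor (C D : category) := Functor {
  fobj :> C -> D;
  fmap : forall X Y, hom C X Y -> hom D (fobj X) (fobj Y);
  fmap_id : forall X, fmap (idm C X) = idm D (fobj X);
  fmap_comp : forall X Y Z (g : hom C Y Z) (f : hom C X Y),
    fmap (g \oc f) = fmap g \oc fmap f }.

Arguments fmap {C D} mu {X Y} f : rename.

Record nattrans (C D : category) (S T : functor C D) := NatTrans {
  ntfun :> forall X, hom D (S X) (T X);
  nt_nat : forall X Y (f : hom C X Y), ntfun Y \oc fmap S f = fmap T f \oc ntfun X }.

Lemma nattrans_ext (C D : category) (S T : functor C D) (a b : nattrans S T) :
  (forall X, a X = b X) -> a = b.
Proof.
case: a b => [a aP] [b bP] /= ab.
have e : a = b by exact: functional_extensionality_dep.
by subst b; rewrite (Prop_irrelevance aP bP).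
Qed.

Definition op (C : category) : category.
Proof.
refine (@Category C (fun X Y => hom C Y X) (idm C) (fun _ _ _ g f => f \oc g) _ _ _).
- by move=> X Y f; exact: comp_idr.
- by move=> X Y f; exact: comp_idl.
- by move=> X Y Z T h g f; exact: esym (comp_assoc _ _ _).
Defined.

Definition full_subcat (C : category) (I : Type) (F : I -> C) : category.
Proof.
refine (@Category I (fun i j => hom C (F i) (F j)) (fun i => idm C (F i))
  (fun _ _ _ g f => g \oc f) _ _ _).
- by move=> X Y f; exact: comp_idl.
- by move=> X Y f; exact: comp_idr.
- by move=> X Y Z T h g f; exact: comp_assoc.
Defined.

Definition SetCat : category :=
  @Category Type (fun A B => A -> B) (fun A x => x) (fun _ _ _ g f x => g (f x))
    (fun _ _ _ => erefl) (fun _ _ _ => erefl) (fun _ _ _ _ _ _ _ => erefl).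

Definition nt_id (C D : category) (S : functor C D) : nattrans S S.
Proof.
by exists (fun X => idm D (S X)) => X Y f; rewrite comp_idl comp_idr.
Defined.

Definition nt_comp (C D : category) (S T U : functor C D)
  (b : nattrans T U) (a : nattrans S T) : nattrans S U.
Proof.
exists (fun X => b X \oc a X) => X Y f.
by rewrite -comp_assoc nt_nat !comp_assoc nt_nat.
Defined.

Definition functor_cat (C D : category) : category.
Proof.
refine (@Category (functor C D) (@nattrans C D) (@nt_id C D) (@nt_comp C D) _ _ _).
- by move=> S T f; apply: nattrans_ext => X; exact: comp_idl.
- by move=> S T f; apply: nattrans_ext => X; exact: comp_idr.
- by move=> S T U W h g f; apply: nattrans_ext => X; exact: comp_assoc.
Defined.

Definition full_faithful (C D : category) (mu : functor C D) :=
  forall X Y (h : hom D (mu X) (mu Y)), exists! f : hom C X Y, fmap mu f = h.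

Definition fmap_inv (C D : category) (mu : functor C D) (muP : full_faithful mu)
  (X Y : C) (h : hom D (mu X) (mu Y)) : hom C X Y := projT1 (cid (muP X Y h)).

Lemma fmap_invK (C D : category) (mu : functor C D) (muP : full_faithful mu)
  (X Y : C) (h : hom D (mu X) (mu Y)) : fmap mu (fmap_inv muP h) = h.
Proof. by rewrite /fmap_inv; case: cid => f []. Qed.

Lemma fmap_inv_uniq (C D : category) (mu : functor C D) (muP : full_faithful mu)
  (X Y : C) (h : hom D (mu X) (mu Y)) (f : hom C X Y) :
  fmap mu f = h -> fmap_inv muP h = f.
Proof. by rewrite /fmap_inv; case: cid => f' fu /= hf; case: fu => ? u; exact: u. Qed.

Record homotopy_system (C : category) := HomotopySystem {
  hstep : forall X Y : C, hom C X Y -> hom C X Y -> Prop;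
  hstep_irr : forall (X Y : C) (f : hom C X Y), ~ hstep f f }.

Definition pullback (C D : category) (mu : functor C D) (S : homotopy_system D) :
  homotopy_system C.
Proof.
exists (fun X Y f g => f <> g /\ (fmap mu f = fmap mu g \/ hstep S (fmap mu f) (fmap mu g))).
by move=> X Y f [].
Defined.

(* A path is a nonempty sequence of vertices. *)
Definition simplicial (V : Type) (s : seq V) := s <> [::] /\ List.NoDup s.

(* Deleting the vertex of a one-vertex path leaves no path, hence the side
   condition in [osc_delete]. *)
Record is_osc (V : Type) (K : seq V -> Prop) : Prop := IsOsc {
  osc_simplicial : forall s, K s -> simplicial s;
  osc_singleton : forall v, K [:: v];
  osc_delete : forall s1 v s2, K (s1 ++ v :: s2) -> s1 ++ s2 <> [::] -> K (s1 ++ s2) }.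

Record osc := Osc { vert : Type; simp : seq vert -> Prop; oscP : is_osc simp }.

Record is_tcmor (K1 K2 : osc) (f : vert K1 -> vert K2) : Prop := IsTcmor {
  tcmor_simp : forall p, simp p -> ~ simplicial (map f p) \/ simp (map f p);
  tcmor_tri : forall v0 v1 v2, simp [:: v0; v1; v2] -> f v0 = f v2 ->
    f v0 = f v1 /\ f v1 = f v2 }.

Record tcmor (K1 K2 : osc) := Tcmor {
  tcfun :> vert K1 -> vert K2;
  tcmorP : is_tcmor tcfun }.

Lemma tcmor_ext (K1 K2 : osc) (f g : tcmor K1 K2) : f =1 g -> f = g.
Proof.
case: f g => [f fP] [g gP] /= fg.
have e : f = g by exact: functional_extensionality_dep.
by subst g; rewrite (Prop_irrelevance fP gP).
Qed.

Lemma is_tcmor_id (K : osc) : @is_tcmor K K id.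
Proof.
split=> [p Kp|v0 v1 v2 K012 e]; first by right; rewrite map_id.
case: (osc_simplicial (oscP K) K012) => _ nd; exfalso; subst v2.
by inversion nd as [|? ? nin]; apply: nin; right; left.
Qed.

Lemma NoDup_map_inv (A B : Type) (f : A -> B) (s : seq A) :
  List.NoDup (map f s) -> List.NoDup s.
Proof. exact: List.NoDup_map_inv. Qed.

Lemma simplicial_map_inv (A B : Type) (f : A -> B) (s : seq A) :
  simplicial (map f s) -> simplicial s.
Proof. by case=> n0 /NoDup_map_inv nd; split => // s0; apply: n0; rewrite s0. Qed.

Lemma is_tcmor_comp (K1 K2 K3 : osc) (g : tcmor K2 K3) (f : tcmor K1 K2) :
  is_tcmor (fun x => g (f x)).
Proof.
have [gs gt] := tcmorP g; have [fs ft] := tcmorP f.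
split=> [p Kp|v0 v1 v2 K012 e].
  rewrite (map_comp g f); have [nf|] := fs _ Kp; last exact: gs.
  by left=> /simplicial_map_inv.
have [f02|nf02] := pselect (f v0 = f v2).
  by have [-> ->] := ft _ _ _ K012 f02.
have [f01|nf01] := pselect (f v0 = f v1); first by rewrite -f01.
have [f12|nf12] := pselect (f v1 = f v2); first by rewrite f12.
apply: gt => //; have [nf|//] := fs _ K012; case: nf; split => //=.
apply: List.NoDup_cons => /=; first by case=> [/esym|[/esym|]].
apply: List.NoDup_cons => /=; first by case=> [/esym|].
by apply: List.NoDup_cons => //; exact: List.NoDup_nil.
Qed.

Definition TcOSC : category.
Proof.
refine (@Category osc tcmor (fun K => Tcmor (is_tcmor_id K))
  (fun _ _ _ g f => Tcmor (is_tcmor_comp g f)) _ _ _).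
- by move=> X Y f; exact: tcmor_ext.
- by move=> X Y f; exact: tcmor_ext.
- by move=> X Y Z T h g f; exact: tcmor_ext.
Defined.

Section Uniq.
Variable V : Type.
Implicit Types s t : seq {classic V}.

Lemma NoDupP s : List.NoDup s <-> uniq s.
Proof.
have InP x t : List.In x t <-> x \in t.
  elim: t => //= y t [IH1 IH2]; rewrite inE; split.
    by case=> [->|/IH1 ->]; rewrite ?eqxx ?orbT.
  by case/orP=> [/eqP ->|/IH2]; [left|right].
elim: s => /= [|x s [IH1 IH2]]; first by split=> // _; exact: List.NoDup_nil.
split=> [nd|/andP[xs us]].
  inversion nd as [|? ? nin nds]; rewrite IH1 // andbT.
  by apply/negP => /InP.
by apply: List.NoDup_cons; [move/InP; exact/negP|exact: IH2].
Qed.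

Lemma simplicialP s : simplicial s <-> (s != [::]) && uniq s.
Proof.
split=> [[n0 /NoDupP us]|/andP[/eqP n0 /NoDupP us]]; last by split.
by rewrite us andbT; apply/eqP.
Qed.

End Uniq.

Section Subseq.
Variables (V : Type) (K : seq V -> Prop) (KP : is_osc K).

Lemma osc_subseq (s t : seq {classic V}) : subseq t s -> t <> [::] -> K s -> K t.
Proof.
case/subseqP => m _ ->{t}.
suff gen pre : pre ++ mask m s <> [::] -> K (pre ++ s) -> K (pre ++ mask m s).
  exact: (gen [::]).
elim: s m pre => [|x s IH] m pre; first by rewrite mask0.
case: m => [|b m] /=.
- rewrite cats0 => n0; elim/last_ind: s {IH} => [|s y IH] Ks.
    by have := osc_delete KP (s1 := pre) (s2 := [::]) Ks; rewrite cats0; apply.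
  apply: IH; have := osc_delete KP (s1 := pre ++ x :: s) (v := y) (s2 := [::]).
  rewrite cats0 -catA /= cats1; apply => //.
  by case: (pre).
- case: b => [|n0 Ks]; first by rewrite -!(cat_rcons x pre); exact: IH.
  apply: IH => //; apply: (osc_delete KP Ks).
  by move=> e; move: n0; case: (pre) e => [|? ?] //= ->; rewrite mask0.
Qed.

End Subseq.

Definition ord_increasing (n : nat) (s : seq 'I_n.+1) :=
  s <> [::] /\ sorted (fun i j : 'I_n.+1 => (i < j)%N) s.

Lemma ord_ltn_trans n : transitive (fun i j : 'I_n.+1 => (i < j)%N).
Proof. by move=> ? ? ?; exact: ltn_trans. Qed.

Lemma is_osc_ordinal n : is_osc (@ord_increasing n).
Proof.
split=> [s [n0 ss]|v|s1 v s2 [_ ss] n0] //.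
- split=> //; apply/NoDupP.
  by apply: (@sorted_uniq {classic 'I_n.+1} _ _ _ _ ss);
    [exact: ord_ltn_trans|move=> i; rewrite ltnn].
- split=> //; apply: subseq_sorted ss; first exact: ord_ltn_trans.
  by rewrite cat_subseq // subseq_cons.
Qed.

Definition ordinal (n : nat) : TcOSC := Osc (is_osc_ordinal n).

Definition Delta : category := full_subcat ordinal.

Definition sSet : category := functor_cat (op Delta) SetCat.

Definition sigma_obj (K : TcOSC) : sSet.
Proof.
refine (@Functor (op Delta) SetCat (fun n => tcmor (ordinal n) K)
  (fun m n (h : hom TcOSC (ordinal n) (ordinal m)) (p : hom TcOSC (ordinal m) K) =>
     p \oc h) _ _).
- by move=> n; apply/funext => p; exact: (@comp_idr TcOSC).
- by move=> l m n h h'; apply/funext => p; exact: (@comp_assoc TcOSC).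
Defined.

Definition sigma_map (K1 K2 : TcOSC) (f : hom TcOSC K1 K2) :
  hom sSet (sigma_obj K1) (sigma_obj K2).
Proof.
exists (fun n (p : hom TcOSC (ordinal n) K1) => f \oc p).
by move=> m n h; apply/funext => p; exact: (@comp_assoc TcOSC).
Defined.

Definition sigma : functor TcOSC sSet.
Proof.
refine (@Functor TcOSC sSet sigma_obj sigma_map _ _).
- by move=> K; apply: nattrans_ext => n; apply/funext => p; exact: (@comp_idl TcOSC).
- move=> K1 K2 K3 g f; apply: nattrans_ext => n; apply/funext => p.
  by apply/esym; exact: (@comp_assoc TcOSC).
Defined.

Definition sset_prod (S T : sSet) : sSet.
Proof.
refine (@Functor (op Delta) SetCat
  (fun n => ((S : functor _ _) n * (T : functor _ _) n)%type)
  (fun m n h x => (fmap S h x.1, fmap T h x.2)) _ _).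
- by move=> n; apply/funext => -[x y] /=; rewrite !fmap_id.
- by move=> l m n h h'; apply/funext => -[x y] /=; rewrite !fmap_comp.
Defined.

Definition sCyl (S : sSet) : sSet := sset_prod S (sigma (ordinal 1)).

Lemma is_tcmor_const (K1 K2 : osc) (v : vert K2) : @is_tcmor K1 K2 (fun=> v).
Proof.
split=> [[|x [|y p]] Kp|] //.
- by case: (osc_simplicial (oscP K1) Kp).
- by right; exact: osc_singleton (oscP K2) v.
- by left=> -[_ nd]; inversion nd as [|? ? nin]; apply: nin; left.
Qed.

Definition tcconst (K1 K2 : osc) (v : vert K2) : tcmor K1 K2 :=
  Tcmor (is_tcmor_const K1 v).

(* [j = ord0, ord_max : 'I_2] are the two vertices of the ordinal [1]. *)
Definition sCyl_end (j : 'I_2) (S : sSet) : hom sSet S (sCyl S).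
Proof.
exists (fun n tau => (tau, @tcconst (ordinal n) (ordinal 1) j)) => m n h.
by apply/funext => tau /=; congr pair; exact: tcmor_ext.
Defined.

Definition sset_homotopy (S1 S2 : sSet) (a b : hom sSet S1 S2)
  (F : hom sSet (sCyl S1) S2) :=
  F \oc sCyl_end ord0 S1 = a /\ F \oc sCyl_end ord_max S1 = b.

Definition sys_sSet : homotopy_system sSet.
Proof.
exists (fun S1 S2 a b => a <> b /\ exists F, @sset_homotopy S1 S2 a b F).
by move=> S1 S2 a [].
Defined.

Definition iota_fun (V : Type) (j : 'I_2) (v : V) : V * 'I_2 := (v, j).

(* For [p = v_0 ... v_k] and [i <= k], the third form is
   [(v_0,0) ... (v_i,0) (v_i,1) ... (v_k,1)]. *)
Definition cyl_path (K : osc) (s : seq (vert K * 'I_2)) :=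
  exists2 p, simp p &
    [\/ s = map (iota_fun ord0) p,
        s = map (iota_fun ord_max) p |
        exists2 i, (i < size p)%N &
          s = map (iota_fun ord0) (take i.+1 p) ++ map (iota_fun ord_max) (drop i p)].

(* The smallest ordered simplicial complex containing [cyl_path K]. *)
Definition cyl_simp (K : osc) (s : seq (vert K * 'I_2)) :=
  forall L, is_osc L -> (forall t, cyl_path t -> L t) -> L s.

Lemma ord2_max (j : 'I_2) : j != ord0 -> j = ord_max.
Proof. by case: j => -[|[|//]] // *; apply: val_inj. Qed.

Section CylChar.
Variable K : osc.
Let i0 := @iota_fun (vert K) ord0.
Let i1 := @iota_fun (vert K) ord_max.

Definition cyl_expl (s : seq (vert K * 'I_2)) :=
  s <> [::] /\ exists a b : seq (vert K), s = map i0 a ++ map i1 b /\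
    (simp (a ++ b) \/
     exists a' v b', [/\ a = rcons a' v, b = v :: b' & simp (a' ++ v :: b')]).

Lemma iota_inj j : injective (@iota_fun (vert K) j).
Proof. by move=> v w []. Qed.

Lemma i0_i1_disj (a b : seq {classic (vert K)}) : ~~ has [in (map i0 a : seq {classic _})] (map i1 b : seq {classic _}).
Proof.
apply/hasPn => x /(@mapP {classic _} {classic _})[w _ ->].
by apply/negP => /(@mapP {classic _} {classic _})[v _ []].
Qed.

Lemma cyl_uniq (a b : seq {classic (vert K)}) : uniq (map i0 a ++ map i1 b : seq {classic _}) = uniq a && uniq b.
Proof.
rewrite cat_uniq i0_i1_disj /=.
by rewrite !(@map_inj_uniq {classic _} {classic _} _ (@iota_inj _)).
Qed.

Lemma map_split (A B : Type) (f : A -> B) (b : seq A) (s1 : seq B) x (s2 : seq B) : map f b = s1 ++ x :: s2 ->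
  exists b1 v b2, [/\ b = b1 ++ v :: b2, s1 = map f b1 & s2 = map f b2].
Proof.
elim: s1 b => [|y s1 IH] [|w b] //=; first by case=> _ <-; exists [::], w, b.
by case=> <- /IH [b1 [v [b2 [-> -> ->]]]]; exists (w :: b1), v, b2.
Qed.

Lemma map2_split (a b : seq (vert K)) (s1 : seq (vert K * 'I_2)) x s2 : map i0 a ++ map i1 b = s1 ++ x :: s2 ->
  (exists a1 v a2, [/\ a = a1 ++ v :: a2, s1 = map i0 a1 & s2 = map i0 a2 ++ map i1 b]) \/
  (exists b1 v b2, [/\ b = b1 ++ v :: b2, s1 = map i0 a ++ map i1 b1 & s2 = map i1 b2]).
Proof.
elim: a s1 => [|u a IH] s1; first by move=> e; right; exact: map_split e.
case: s1 => [|y s1] /=; first by move=> [_ e]; left; exists [::], u, a; rewrite e.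
case=> <- e; have [[a1 [v [a2 [-> -> ->]]]]|[b1 [v [b2 [-> -> ->]]]]] := IH _ e.
  by left; exists (u :: a1), v, a2.
by right; exists b1, v, b2.
Qed.

Lemma is_osc_cyl_expl : is_osc cyl_expl.
Proof.
have KP := oscP K; split.
- move=> s [n0 [a [b [es ab]]]]; split=> //; apply/NoDupP; rewrite es cyl_uniq.
  case: ab => [/(osc_simplicial KP)[_ /NoDupP]|[a' [v [b' [-> -> /(osc_simplicial KP)[_ /NoDupP]]]]]].
    by rewrite cat_uniq => /and3P[-> _ ->].
  rewrite cat_uniq rcons_uniq => /and3P[-> /= + /andP[-> ->]].
  by rewrite negb_or => /andP[-> _].
- case=> v j; split=> //; have [j0|j0] := eqVneq j ord0.
    by exists [:: v], [::]; subst j; split=> //; left; exact: (osc_singleton KP).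
  exists [::], [:: v]; split; last by left; exact: (osc_singleton KP).
  by rewrite (ord2_max j0).
- move=> s1 x s2 [_ [a [b [/esym/map2_split es ab]]]] n0; split=> //.
  have n0' (c d : seq (vert K)) : s1 ++ s2 = map i0 c ++ map i1 d -> c ++ d <> [::].
    by move=> e cd; apply: n0; rewrite e; case: c d cd {e} => [|? ?] [|? ?].
  case: es => [[a1 [w [a2 [ea e1 e2]]]]|[b1 [w [b2 [eb e1 e2]]]]].
    have e : s1 ++ s2 = map i0 (a1 ++ a2) ++ map i1 b by rewrite e1 e2 map_cat catA.
    exists (a1 ++ a2), b; split=> //; have := n0' _ _ e => n1.
    case: ab => [Kab|[a' [v [b' [ea' eb Kab]]]]].
      left; rewrite -catA; apply: (osc_delete KP (v := w)); first by rewrite ea -catA in Kab.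
      by rewrite catA.
    case/lastP: a2 ea {e e2 n0'} n1 => [|a2 z] ea n1.
      have [<- _] : (a', v) = (a1, w).
        by apply/rcons_inj; rewrite -ea' ea cats1.
      by left; rewrite cats0 eb.
    have [ea'' vz] : (a', v) = (a1 ++ w :: a2, z).
      by apply/rcons_inj; rewrite -ea' ea rcons_cat.
    right; exists (a1 ++ a2), v, b'; split=> //; first by rewrite vz rcons_cat.
    rewrite -catA; apply: (osc_delete KP (v := w)); first by rewrite ea'' -catA in Kab.
    by rewrite catA; case: (a1 ++ a2).
  have e : s1 ++ s2 = map i0 a ++ map i1 (b1 ++ b2) by rewrite e1 e2 map_cat catA.
  exists a, (b1 ++ b2); split=> //; have := n0' _ _ e => n1.
  case: ab => [Kab|[a' [v [b' [ea eb' Kab]]]]].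
    left; rewrite catA; apply: (osc_delete KP (v := w)); first by rewrite eb catA in Kab.
    by rewrite -catA.
  case: b1 eb {e e1} n1 => [|z b1] eb n1; move: eb'; rewrite eb => -[vz b'E].
    by left; rewrite ea b'E cat_rcons.
  right; exists a', z, (b1 ++ b2); split=> //; first by rewrite ea vz.
  move: Kab; rewrite -vz -b'E => Kab.
  have := @osc_delete _ _ KP (a' ++ z :: b1) w b2.
  by rewrite -!catA; apply=> //; case: (a').
Qed.

Lemma cyl_explP s : cyl_simp s <-> cyl_expl s.
Proof.
have KP := oscP K; split=> [/(_ _ is_osc_cyl_expl)|].
  apply=> {}s [p Kp]; have [p0 _] := osc_simplicial KP Kp.
  case=> [es|es|[i ip es]]; split; rewrite es.
  - by case: (p) p0.
  - by exists p, [::]; rewrite !cats0; split=> //; left.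
  - by case: (p) p0.
  - by exists [::], p; split=> //; left.
  - by case: (p) ip.
  - exists (take i.+1 p), (drop i p); split=> //; right.
    case: (p) p0 ip Kp => // v0 p' _ ip Kp.
    exists (take i (v0 :: p')), (nth v0 (v0 :: p') i), (drop i.+1 (v0 :: p')).
    rewrite -take_nth // -drop_nth //; split=> //.
    by rewrite cat_take_drop.
case=> n0 [a [b [es ab]]] L LP cL; rewrite es.
case: ab => [Kab|[a' [v [b' [-> -> Kab]]]]].
  case: b es Kab => [|v b] es Kab.
    rewrite cats0; apply: cL; exists a; first by rewrite cats0 in Kab.
    by constructor 1.
  case: a es Kab => [|u a] es Kab; first by apply: cL; exists (v :: b) => //; constructor 2.
  rewrite [map i1 _]/=; set A := u :: a.
  apply: (@osc_delete _ _ LP (map i0 A) (v, ord0) ((v, ord_max) :: map i1 b)) => //.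
  apply: cL; exists (A ++ v :: b) => //; constructor 3; exists (size A).
    by rewrite size_cat /= -addSnnS leq_addr.
  rewrite drop_size_cat // -(cat_rcons v A b) take_size_cat ?size_rcons //.
  by rewrite map_rcons cat_rcons.
apply: cL; exists (a' ++ v :: b') => //; constructor 3; exists (size a').
  by rewrite size_cat /= -addSnnS leq_addr.
by rewrite -{1}cat_rcons take_size_cat ?size_rcons // drop_size_cat.
Qed.

End CylChar.

Lemma is_osc_cyl (K : osc) : is_osc (@cyl_simp K).
Proof.
have LP := is_osc_cyl_expl K; split=> [s|v|s1 v s2 /cyl_explP Ks n0].
- by move=> /cyl_explP; exact: (osc_simplicial LP).
- by apply/cyl_explP; exact: (osc_singleton LP).
- by apply/cyl_explP; exact: (osc_delete LP Ks).
Qed.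

Definition cylbar (K : TcOSC) : TcOSC := Osc (is_osc_cyl K).

Lemma is_tcmor_iota (K : TcOSC) (j : 'I_2) : @is_tcmor K (cylbar K) (iota_fun j).
Proof.
split=> [p Kp|v0 v1 v2 K012 [e]]; last first.
  by have [-> ->] := tcmor_tri (is_tcmor_id K) K012 e.
right=> L _; apply; exists p => //.
have [->|j0] := eqVneq j ord0; first by constructor 1.
rewrite (ord2_max j0).
by constructor 2.
Qed.

Definition cylbar_end (j : 'I_2) (K : TcOSC) : hom TcOSC K (cylbar K) :=
  Tcmor (is_tcmor_iota K j).

Definition tc_homotopy (K1 K2 : TcOSC) (f g : hom TcOSC K1 K2)
  (F : hom TcOSC (cylbar K1) K2) :=
  F \oc cylbar_end ord0 K1 = f /\ F \oc cylbar_end ord_max K1 = g.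

Definition sys_TcOSC : homotopy_system TcOSC.
Proof.
exists (fun K1 K2 f g => f <> g /\ exists F, @tc_homotopy K1 K2 f g F).
by move=> K1 K2 f [].
Defined.

Lemma ord_increasingP n (s : seq 'I_n.+1) :
  simplicial s -> sorted (fun i j : 'I_n.+1 => (i <= j)%N) s -> ord_increasing s.
Proof.
case=> n0 /NoDupP us ss; split=> //.
suff : sorted ltn (map val s) by rewrite sorted_map.
rewrite ltn_sorted_uniq_leq sorted_map ss andbT.
by rewrite (@map_inj_uniq {classic _} nat _ (@val_inj _ _ _)).
Qed.

Lemma snd_sorted (V : Type) (a b : seq V) :
  sorted (fun i j : 'I_2 => (i <= j)%N)
    (map snd (map (iota_fun ord0) a ++ map (iota_fun ord_max) b)).
Proof.
have pb v : path (fun i j : 'I_2 => (i <= j)%N) v (map snd (map (iota_fun ord_max) b)).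
  by elim: b v => //= w b IH v; rewrite IH andbT -ltnS ltn_ord.
case: a => [|u a] /=; first by case: b pb => //= w b /(_ ord0)/andP[].
by elim: a.
Qed.

Lemma simplicial2 (V : Type) (v w : V) : v <> w -> simplicial [:: v; w].
Proof.
move=> vw; split=> //; apply/NoDupP; rewrite /= inE andbT.
by apply/eqP.
Qed.

Lemma is_tcmor_fst (K : TcOSC) : @is_tcmor (cylbar K) K fst.
Proof.
have mfst (a b : seq (vert K)) :
    map fst (map (iota_fun ord0) a ++ map (iota_fun ord_max) b) = a ++ b.
  by rewrite map_cat -!map_comp !map_id.
split=> [p /cyl_explP[_ [a [b [-> ab]]]]|x0 x1 x2 /cyl_explP[_ [a [b [e ab]]]] e02].
  rewrite mfst; case: ab => [|[a' [v [b' [-> -> _]]]]]; first by right.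
  left=> -[_ /NoDupP]; rewrite cat_uniq => /and3P[_ /hasPn/(_ v)].
  by rewrite inE eqxx mem_rcons inE eqxx => /(_ isT).
have := congr1 (map fst) e; rewrite mfst /=; case: ab => [Kab|[a' [v [b' [-> -> Kab]]]]] e'.
  by rewrite -e' in Kab; exact: (tcmor_tri (is_tcmor_id K) Kab e02).
have [_ /NoDupP] := osc_simplicial (oscP K) Kab.
case: a' e' {Kab} => [|w [|? [|? l]]] //=.
- by case=> e0 _ eb; rewrite -eb inE -e0 e02 eqxx.
- by case=> e0 _ e2 _; rewrite inE -e0 -e2 e02 eqxx.
- by case=> _ _ _; case: l.
Qed.

Lemma is_tcmor_snd (K : TcOSC) : @is_tcmor (cylbar K) (ordinal 1) snd.
Proof.
split=> [p /cyl_explP[_ [a [b [-> _]]]]|x0 x1 x2 /cyl_explP[_ [a [b [e _]]]] e02].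
  have [sp|] := pselect (simplicial (map snd (map (iota_fun ord0) a ++ map (iota_fun ord_max) b))).
    by right; apply: ord_increasingP sp _; exact: snd_sorted.
  by left.
have := snd_sorted a b; rewrite -e /= -e02 => /and3P[l01 l10 _].
suff -> : x1.2 = x0.2 by [].
by apply/val_inj/eqP; rewrite eqn_leq l01 l10.
Qed.

Definition pi_K (K : TcOSC) : hom TcOSC (cylbar K) K := Tcmor (is_tcmor_fst K).

Definition pi_1 (K : TcOSC) : hom TcOSC (cylbar K) (ordinal 1) :=
  Tcmor (is_tcmor_snd K).

Definition phi (K : TcOSC) : hom sSet (sigma (cylbar K)) (sCyl (sigma K)).
Proof.
exists (fun n (p : hom TcOSC (ordinal n) (cylbar K)) => (pi_K K \oc p, pi_1 K \oc p)).
by move=> m n h; apply/funext => p; congr pair; exact: tcmor_ext.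
Defined.

Lemma ordinal_edge n (i j : 'I_n.+1) : (i < j)%N -> @simp (ordinal n) [:: i; j].
Proof. by move=> ij; split; rewrite //= ij. Qed.

Lemma tcmor_ord_leq n m (q : tcmor (ordinal n) (ordinal m)) (i j : 'I_n.+1) :
  (i <= j)%N -> (q i <= q j)%N.
Proof.
rewrite leq_eqVlt => /orP[/eqP/val_inj -> //|ij].
have [qij|/eqP qij] := eqVneq (q i) (q j); first by rewrite qij.
have sq := simplicial2 qij.
case: (tcmor_simp (tcmorP q) (ordinal_edge ij)) => // -[_ /=].
by rewrite andbT => /ltnW.
Qed.

Lemma sorted_split n (q : 'I_n.+1 -> 'I_2) (s : seq 'I_n.+1) :
  (forall i j : 'I_n.+1, (i <= j)%N -> (q i <= q j)%N) ->
  sorted (fun i j : 'I_n.+1 => (i < j)%N) s ->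
  exists s0 s1, [/\ s = s0 ++ s1, all (fun i => q i == ord0) s0 &
    all (fun i => q i == ord_max) s1].
Proof.
move=> qle; elim: s => [|i s IH] ss; first by exists [::], [::].
have [qi|qi] := eqVneq (q i) ord0.
  have [s0 [s1 [-> a0 a1]]] := IH (path_sorted ss).
  by exists (i :: s0), s1; split=> //=; rewrite qi eqxx.
exists [::], (i :: s); split=> //=; rewrite (ord2_max qi) eqxx /=.
apply/allP => j js; apply/eqP/val_inj/eqP; rewrite eqn_leq -ltnS ltn_ord /=.
have := order_path_min (@ord_ltn_trans n) ss => /allP/(_ _ js)/ltnW/qle.
by rewrite (ord2_max qi).
Qed.

Section Pair.
Variables (K : TcOSC) (n : nat).
Variables (p : tcmor (ordinal n) K) (q : tcmor (ordinal n) (ordinal 1)).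

Lemma tri_eq (i j k : 'I_n.+1) : (i < j)%N -> (j < k)%N -> p i = p k ->
  p i = p j /\ p j = p k.
Proof.
by move=> ij jk; apply: (tcmor_tri (tcmorP p)); split=> //=; rewrite ij jk.
Qed.

Lemma is_tcmor_pair : @is_tcmor (ordinal n) (cylbar K) (fun i => (p i, q i)).
Proof.
split=> [s [s0 ss]|i j k ijk [pik qik]]; last first.
  have [-> ->] := tcmor_tri (tcmorP p) ijk pik.
  by have [-> ->] := tcmor_tri (tcmorP q) ijk qik.
have [sr|] := pselect (simplicial (map (fun i => (p i, q i)) s)); last by left.
right; apply/cyl_explP; split; first by case: sr.
have [a [b [es qa qb]]] := sorted_split (@tcmor_ord_leq _ _ q) ss.
have ema : map (fun i => (p i, q i)) a = map (iota_fun ord0) (map p a).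
  by rewrite -map_comp; apply/eq_in_map => i ia; rewrite /= (eqP (allP qa _ ia)).
have emb : map (fun i => (p i, q i)) b = map (iota_fun ord_max) (map p b).
  by rewrite -map_comp; apply/eq_in_map => i ib; rewrite /= (eqP (allP qb _ ib)).
have er : map (fun i => (p i, q i)) s =
    map (iota_fun ord0) (map p a) ++ map (iota_fun ord_max) (map p b).
  by rewrite es map_cat ema emb.
have /andP[ua ub] : uniq (map p a : seq {classic _}) && uniq (map p b : seq {classic _}).
  by rewrite -cyl_uniq -er; apply/NoDupP; case: sr.
exists (map p a), (map p b); split=> //.
have sub_s t : subseq t s -> t <> [::] -> uniq (map p t : seq {classic _}) -> simp (map p t).
  move=> ts t0 ut.
  have tP : @simp (ordinal n) t.
    by split=> //; apply: subseq_sorted ss => //; exact: ord_ltn_trans.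
  case: (tcmor_simp (tcmorP p) tP) => // -[]; split; last exact/NoDupP.
  by case: (t) t0.
have lt_ab i j : i \in a -> j \in b -> (i < j)%N.
  move: ss; rewrite (sorted_pairwise (@ord_ltn_trans n)) es pairwise_cat.
  by move=> /and3P[/allrelP r _ _] ia jb; exact: r.
have [u|nu] := boolP (uniq (map p s : seq {classic _})).
  by left; rewrite -map_cat -es; exact: sub_s.
right; rewrite es map_cat cat_uniq ua ub andbT /= negbK in nu.
have lt_a a' l i : a = rcons a' l -> i \in a' -> (i < l)%N.
  move=> ea ia; move: ss; rewrite (sorted_pairwise (@ord_ltn_trans n)) es ea.
  rewrite pairwise_cat -cats1 pairwise_cat => /and3P[_ /and3P[/allrelP r _ _] _].
  by apply: r; rewrite ?inE.
have lt_b m b' j : b = m :: b' -> j \in b' -> (m < j)%N.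
  move=> eb jb; move: ss; rewrite (sorted_pairwise (@ord_ltn_trans n)) es eb.
  by rewrite pairwise_cat => /and3P[_ _ /= /andP[/allP r _]]; exact: r.
have neq_a a' l i : a = rcons a' l -> i \in a' -> p i <> p l.
  move=> ea ia e; move: ua; rewrite ea map_rcons rcons_uniq -e.
  by rewrite (@map_f _ {classic _}).
have neq_b m b' j : b = m :: b' -> j \in b' -> p m <> p j.
  move=> eb jb e; move: ub; rewrite eb /= e.
  by rewrite (@map_f _ {classic _}).
case/lastP ea : a => [|a' l]; first by rewrite ea /= has_sym in nu.
case eb : b => [|m b']; first by rewrite eb in nu.
have plm : p l = p m.
  case/hasP: nu => x /(@mapP _ {classic _})[j jb ->] /(@mapP _ {classic _})[i ia pij].
  have : l \in a by rewrite ea mem_rcons inE eqxx.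
  have : m \in b by rewrite eb inE eqxx.
  move=> mb la.
  move: ia jb; rewrite ea eb mem_rcons !inE => /orP[/eqP il|ia] /orP[/eqP jm|jb].
  - by rewrite -il -jm.
  - have [e _] := tri_eq (lt_ab _ _ la mb) (lt_b _ _ _ eb jb) (esym (etrans pij (congr1 p il))).
    by [].
  - have [e _] := tri_eq (lt_a _ _ _ ea ia) (lt_ab _ _ la mb) (esym (etrans (congr1 p (esym jm)) pij)).
    by case: (neq_a _ _ _ ea ia).
  - have jb' : j \in b by rewrite eb inE jb orbT.
    have [e _] := tri_eq (lt_a _ _ _ ea ia) (lt_ab _ _ la jb') (esym pij).
    by case: (neq_a _ _ _ ea ia).
exists (map p a'), (p m), (map p b'); split=> //; first by rewrite map_rcons plm.
rewrite -[_ :: _]/(map p (m :: b')) -map_cat -eb; apply: sub_s.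
- by rewrite es ea cat_subseq // -cats1 prefix_subseq.
- by rewrite eb; case: (a').
rewrite map_cat cat_uniq ub andbT; apply/andP; split.
  by move: ua; rewrite ea map_rcons rcons_uniq => /andP[].
apply/hasPn => x /(@mapP _ {classic _})[j jb ->].
apply/negP => /(@mapP _ {classic _})[i ia pij].
have la : l \in a by rewrite ea mem_rcons inE eqxx.
have [e _] := tri_eq (lt_a _ _ _ ea ia) (lt_ab _ _ la jb) (esym pij).
exact: (neq_a _ _ _ ea ia).
Qed.

End Pair.

Definition phi_inv (K : TcOSC) : hom sSet (sCyl (sigma K)) (sigma (cylbar K)).
Proof.
exists (fun n (x : tcmor (ordinal n) K * tcmor (ordinal n) (ordinal 1)) =>
  Tcmor (is_tcmor_pair x.1 x.2) : tcmor (ordinal n) (cylbar K)).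
by move=> m n h; apply/funext => x; exact: tcmor_ext.
Defined.

Lemma phiK (K : TcOSC) : phi_inv K \oc phi K = idm sSet _.
Proof.
by apply: nattrans_ext => n; apply/funext => p; apply: tcmor_ext => i /=; case: (p i).
Qed.

Lemma phi_invK (K : TcOSC) : phi K \oc phi_inv K = idm sSet _.
Proof.
apply: nattrans_ext => n; apply/funext => -[p q].
by congr pair; exact: tcmor_ext.
Qed.

Lemma simplex_tcmor (K : osc) (v0 : vert K) (s : seq (vert K)) n :
  simp s -> size s = n.+1 -> @is_tcmor (ordinal n) K (fun i => nth v0 s i).
Proof.
move=> Ks sz; have [_ /NoDupP us] := osc_simplicial (oscP K) Ks.
split=> [t [t0 st]|i j k [_ /= /and3P[ij jk _]] ik].
  right; apply: (osc_subseq (oscP K) _ _ Ks); last by case: (t) t0.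
  have -> : map (fun i : 'I_n.+1 => nth v0 s i) t = map (nth v0 s) (map val t).
    by rewrite -map_comp.
  rewrite -{2}(mkseq_nth v0 s); apply: (@map_subseq nat {classic _}).
  rewrite sz; have -> : map val t = filter (mem (map val t)) (iota 0 n.+1).
    apply: (irr_sorted_eq ltn_trans ltnn).
    - by rewrite sorted_map.
    - by apply: sorted_filter; [exact: ltn_trans|exact: iota_ltn_sorted].
    move=> i; rewrite mem_filter mem_iota /= add0n andbC.
    by case: (boolP (i \in _)) => [/mapP[j _ ->]|]; rewrite ?ltn_ord ?andbF.
  exact: filter_subseq.
have : (i == k :> nat) by rewrite -(@nth_uniq {classic _} v0 s) ?sz //; apply/eqP.
by rewrite ltn_eqF // (ltn_trans ij).
Qed.

Definition vmap (K1 K2 : TcOSC) (h : hom sSet (sigma K1) (sigma K2)) (v : vert K1) :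
  vert K2 := (h : nattrans _ _) 0 (@tcconst (ordinal 0) K1 v) ord0.

Lemma vmapE (K1 K2 : TcOSC) (h : hom sSet (sigma K1) (sigma K2)) n
  (p : tcmor (ordinal n) K1) (i : 'I_n.+1) :
  ((h : nattrans _ _) n p : tcmor (ordinal n) K2) i = vmap h (p i).
Proof.
have := @nt_nat (op Delta) SetCat (sigma K1) (sigma K2) h n 0
  (@tcconst (ordinal 0) (ordinal n) i).
move=> /(congr1 (fun u : tcmor (ordinal n) K1 -> tcmor (ordinal 0) K2 => u p ord0)) /= <-.
by rewrite /vmap; set c := Tcmor _; have -> : c = tcconst (ordinal 0) (p i) by exact: tcmor_ext.
Qed.

Lemma is_tcmor_vmap (K1 K2 : TcOSC) (h : hom sSet (sigma K1) (sigma K2)) :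
  is_tcmor (vmap h).
Proof.
split=> [[|v0 p] Kp|v0 v1 v2 K012 e].
- by case: (osc_simplicial (oscP K1) Kp).
- pose P := Tcmor (simplex_tcmor v0 Kp (erefl (size p).+1)).
  have inc : @simp (ordinal (size p)) (ord_enum (size p).+1).
    split; first by move/(congr1 (map val)); rewrite val_ord_enum.
    have : sorted ltn (map val (ord_enum (size p).+1)).
      by rewrite val_ord_enum iota_ltn_sorted.
    by rewrite sorted_map.
  have := tcmor_simp (tcmorP ((h : nattrans _ _) (size p) P : tcmor (ordinal (size p)) K2)) inc.
  suff -> : map ((h : nattrans _ _) (size p) P : tcmor (ordinal (size p)) K2)
      (ord_enum (size p).+1) = map (vmap h) (v0 :: p) by [].
  rewrite (eq_map (vmapE h P)) (map_comp (vmap h) P); congr map.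
  rewrite /P /= (map_comp (nth v0 (v0 :: p)) val) val_ord_enum.
  exact: (mkseq_nth v0 (v0 :: p)).
- pose P := Tcmor (simplex_tcmor v0 K012 (erefl 3)).
  pose j0 : 'I_3 := ord0; pose j2 : 'I_3 := ord_max; pose j1 : 'I_3 := @Ordinal 3 1 isT.
  have inc : @simp (ordinal 2) [:: j0; j1; j2] by [].
  have := tcmor_tri (tcmorP ((h : nattrans _ _) 2 P : tcmor (ordinal 2) K2)) inc.
  by rewrite !vmapE /=; apply.
Qed.

Lemma sigma_full_faithful : full_faithful sigma.
Proof.
move=> K1 K2 h; exists (Tcmor (is_tcmor_vmap h)); split.
  apply: nattrans_ext => n; apply/funext => p; apply: tcmor_ext => i.
  exact: esym (vmapE h p i).
by move=> f <-; apply: tcmor_ext => v.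
Qed.

Definition sigma_inv (K1 K2 : TcOSC) (h : hom sSet (sigma K1) (sigma K2)) :
  hom TcOSC K1 K2 := fmap_inv sigma_full_faithful h.

(* Main.v *)
From mathcomp Require Import all_boot boolp.
Require Import Defs.
Local Open Scope cat_scope.

(** Both notions of homotopy are given by a map out of a cylinder, tested on
    the two ends of that cylinder.  The isomorphism [phi] between
    [sigma (cylbar K)] and [sCyl (sigma K)] matches these ends: it carries the
    image under [sigma] of the inclusion [cylbar_end j K] to
    [sCyl_end j (sigma K)] ([phi_end]), because a simplex [p] of [K] placed at
    height [j] has coordinates [p] and the constant [j].  Restricting to an end
    therefore commutes with [sigma] and [phi].  This gives statement 1 by
    functoriality, and statement 2 because [sigma], being faithful, reflects
    the equations that say what a homotopy restricts to.

    The two homotopy systems then have the same edges: an edge of the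
    pull-back at [f <> g] cannot come from [sigma f = sigma g], again by
    faithfulness, so it comes from a simplicial homotopy, and statements 1
    and 2 translate homotopies in both directions. *)

Lemma full_faithful_inj {C D : category} {mu : functor C D} {X Y : C}
  {f g : hom C X Y} : full_faithful mu -> fmap mu f = fmap mu g -> f = g.
Proof.
move=> muP efg; case: (muP X Y (fmap mu g)) => h [_ hu].
by rewrite -(hu f efg) -(hu g erefl).
Qed.

(** Steps are propositions, so a homotopy system is determined by which pairs
    of morphisms it relates. *)
Lemma homotopy_system_ext (C : category) (S T : homotopy_system C) :
  (forall (X Y : C) (f g : hom C X Y), hstep S f g <-> hstep T f g) -> S = T.
Proof.
case: S T => [s sP] [t tP] /= st.
have e : s = t.
  do 2 (apply: functional_extensionality_dep => ?).
  by apply/funext => f; apply/funext => g; apply/propext; exact: st.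
by subst t; rewrite (Prop_irrelevance sP tP).
Qed.

(** The coordinates of [i |-> (p i, j)] are [p] and the constant [j]. *)
Lemma phi_end (K : TcOSC) (j : 'I_2) :
  phi K \oc fmap sigma (cylbar_end j K) = sCyl_end j (sigma K).
Proof.
apply: nattrans_ext => n; apply/funext => p.
by congr pair; exact: tcmor_ext.
Qed.

Lemma phi_inv_end (K : TcOSC) (j : 'I_2) :
  phi_inv K \oc sCyl_end j (sigma K) = fmap sigma (cylbar_end j K).
Proof. by rewrite -phi_end comp_assoc phiK comp_idl. Qed.

Lemma sset_homotopy_sigma (K1 K2 : TcOSC) (f g : hom TcOSC K1 K2)
  (F : hom TcOSC (cylbar K1) K2) :
  tc_homotopy f g F ->
  sset_homotopy (fmap sigma f) (fmap sigma g) (fmap sigma F \oc phi_inv K1).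
Proof. by case=> <- <-; split; rewrite -comp_assoc phi_inv_end -fmap_comp. Qed.

Lemma tc_homotopy_sigma_inv (K1 K2 : TcOSC) (f g : hom TcOSC K1 K2)
  (F : hom sSet (sCyl (sigma K1)) (sigma K2)) :
  sset_homotopy (fmap sigma f) (fmap sigma g) F ->
  tc_homotopy f g (sigma_inv (F \oc phi K1)).
Proof.
case=> F0 F1; split; apply: (full_faithful_inj sigma_full_faithful);
  by rewrite fmap_comp /sigma_inv fmap_invK -comp_assoc phi_end.
Qed.

Theorem corollary4p21 :
  (forall (K1 K2 : TcOSC) (f g : hom TcOSC K1 K2),
     (forall F : hom TcOSC (cylbar K1) K2,
        tc_homotopy f g F ->
        sset_homotopy (fmap sigma f) (fmap sigma g) (fmap sigma F \oc phi_inv K1)) /\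
     (forall F : hom sSet (sCyl (sigma K1)) (sigma K2),
        sset_homotopy (fmap sigma f) (fmap sigma g) F ->
        tc_homotopy f g (sigma_inv (F \oc phi K1)))) /\
  pullback sigma sys_sSet = sys_TcOSC.
Proof.
split=> [K1 K2 f g|].
  by split=> F; [exact: sset_homotopy_sigma|exact: tc_homotopy_sigma_inv].
apply: homotopy_system_ext => K1 K2 f g; split=> -[fg H]; split=> //.
  case: H => [/(full_faithful_inj sigma_full_faithful)//|[_ [F FP]]].
  by exists (sigma_inv (F \oc phi K1)); exact: tc_homotopy_sigma_inv.
case: H => F FP; right; split.
  by move/(full_faithful_inj sigma_full_faithful).
by exists (fmap sigma F \oc phi_inv K1); exact: sset_homotopy_sigma.
Qed.
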